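(* Consider the discrete-time LQR problem with data $A\in\mathbb{R}^{m\times m}$, $B\in\mathbb{R}^{m\times r}$, and block diagonal symmetric positive definite $Q\in\mathbb{R}^{m\times m}$, $R\in\mathbb{R}^{r\times r}$, decomposed into $n$ subsystems. Let $F^0\in\mathbb{R}^{r\times m}$ be an arbitrary initial guess, let $i\in\{1,\dots,n\}$ be arbitrary, and let $(F^k)_{k\ge 0}$ be the iterates of the split optimal policy iteration started with $F^0$ and updating the $i$-th subsystem first. If the pair $(A^{(i)}(F^0),B^{(i)})$ is controllable, then: (i) all iterates $F^k$, $k\ge 1$, stabilize the global system, i.e. all eigenvalues of $A+BF^k$ have modulus less than $1$; (ii) the value functions $V^k$ corresponding to the $F^k$ satisfy $V^{k+1}(x)\le V^k(x)$ for all $x\in\mathbb{R}^m$ and all $k\ge 0$; (iii) $F^k\to F^{\mathrm{opt}}$ as $k\to\infty$, where $F^{\mathrm{opt}}$ is the optimal feedback matrix of the original problem.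
   Context: Discrete-time LQR problem: the system is $x(\ell+1)=Ax(\ell)+Bu(\ell)$ with accumulated cost $\sum_{\ell\ge0}x(\ell)^{T}Qx(\ell)+u(\ell)^{T}Ru(\ell)$ to be minimized. The optimal feedback is $u=F^{\mathrm{opt}}x$ with $F^{\mathrm{opt}}=-(R+B^{T}P^{\mathrm{opt}}B)^{-1}B^{T}P^{\mathrm{opt}}A$, where $P^{\mathrm{opt}}$ is the unique symmetric positive definite solution of the discrete algebraic Riccati equation $P=A^{T}PA-A^{T}PB(R+B^{T}PB)^{-1}B^{T}PA+Q$. Subsystems: the inputs are partitioned as $r=r_1+\dots+r_n$ and the states as $m=m_1+\dots+m_n$; $R$ is block diagonal with blocks of sizes $r_1,\dots,r_n$ and $Q$ is block diagonal with blocks of sizes $m_1,\dots,m_n$. For $i=1,\dots,n$, $\Pi_i\in\mathbb{R}^{r\times r_i}$ is the block column matrix whose $i$-th block is the identity and whose other blocks are $0$. For $F\in\mathbb{R}^{r\times m}$ put $$A^{(i)}(F)=A+B(I-\Pi_i\Pi_i^{T})F,\quad B^{(i)}=B\Pi_i,$$ $$Q^{(i)}(F)=Q+F^{T}(I-\Pi_i\Pi_i^{T})R(I-\Pi_i\Pi_i^{T})F,\quad R^{(i)}=\Pi_i^{T}R\Pi_i .$$ Update of subsystem $i$: given $F$, let $P^{\mathrm{new}}$ be the unique symmetric positive definite solution of the discrete Riccati equation above with $(A,B,Q,R)$ replaced by $(A^{(i)}(F),B^{(i)},Q^{(i)}(F),R^{(i)})$. The updated matrix $g^i(F)=F^{\mathrm{new}}$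 is defined by $$\Pi_i^{T}F^{\mathrm{new}}=-\big(R^{(i)}+(B^{(i)})^{T}P^{\mathrm{new}}B^{(i)}\big)^{-1}(B^{(i)})^{T}P^{\mathrm{new}}A^{(i)}(F),\qquad (I-\Pi_i\Pi_i^{T})F^{\mathrm{new}}=(I-\Pi_i\Pi_i^{T})F .$$ Split optimal policy iteration started at $F^0$ with subsystem $i$ first: $F^{k+1}=g^{i_k}(F^k)$ for $k\ge 0$, where $i_0=i$ and the indices sweep cyclically through the subsystems ($i_{k+1}=i_k+1$ if $i_k<n$, and $i_{k+1}=1$ if $i_k=n$). Value function: $V^k(x)\in[0,\infty]$ is the cost $\sum_{\ell\ge0}x(\ell)^{T}Qx(\ell)+u(\ell)^{T}Ru(\ell)$ along $x(\ell+1)=(A+BF^k)x(\ell)$, $x(0)=x$, with $u(\ell)=F^kx(\ell)$. *)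

(* Defs.v *)
From mathcomp Require Import all_boot all_order all_algebra.
From mathcomp Require Import complex.
From mathcomp Require Import all_classical all_reals all_analysis.

Set Implicit Arguments.
Unset Strict Implicit.
Unset Printing Implicit Defensive.

Import Order.TTheory GRing.Theory Num.Theory.
Import numFieldNormedType.Exports.

Local Open Scope classical_set_scope.
Local Open Scope ring_scope.

Definition qform (K : realType) (m : nat) (Q : 'M[K]_m) (x : 'cV[K]_m) : K :=
  (x^T *m Q *m x) 0 0.

Definition sym_posdef (K : realType) (m : nat) (Q : 'M[K]_m) : Prop :=
  Q^T = Q /\ forall x : 'cV[K]_m, x != 0 -> 0 < qform Q x.

(* Kalman's definition: [B, AB, ..., A^(m-1) B] has full row rank. *)
Definition controllable (K : realType) (m r : nat)
    (A : 'M[K]_m) (B : 'M[K]_(m, r)) : Prop :=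
  \rank (\mxrow_(k < m) (A ^+ k *m B)) = m.

Definition schur_stable (K : realType) (m : nat) (A : 'M[K]_m) : Prop :=
  forall z : complex K, eigenvalue (map_mx (real_complex K) A) z -> `|z| < 1.

Definition riccati_map (K : realType) (m r : nat) (A : 'M[K]_m)
    (B : 'M[K]_(m, r)) (Q : 'M[K]_m) (R : 'M[K]_r) (P : 'M[K]_m) : 'M[K]_m :=
  A^T *m P *m A
  - A^T *m P *m B *m invmx (R + B^T *m P *m B) *m B^T *m P *m A + Q.

Definition riccati_sol (K : realType) (m r : nat) (A : 'M[K]_m)
    (B : 'M[K]_(m, r)) (Q : 'M[K]_m) (R : 'M[K]_r) (P : 'M[K]_m) : Prop :=
  sym_posdef P /\ P = riccati_map A B Q R P.

(* Definite description: the symmetric positive definite solution if there is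
   exactly one, and the dummy value 0 otherwise. *)
Definition the_riccati_sol (K : realType) (m r : nat) (A : 'M[K]_m)
    (B : 'M[K]_(m, r)) (Q : 'M[K]_m) (R : 'M[K]_r) : 'M[K]_m :=
  xget 0 [set P | unique (riccati_sol A B Q R) P].

Definition opt_feedback (K : realType) (m r : nat) (A : 'M[K]_m)
    (B : 'M[K]_(m, r)) (Q : 'M[K]_m) (R : 'M[K]_r) : 'M[K]_(r, m) :=
  let P := the_riccati_sol A B Q R in
  - (invmx (R + B^T *m P *m B) *m B^T *m P *m A).

Definition lqr_cost (K : realType) (m r : nat) (Q : 'M[K]_m) (R : 'M[K]_r)
    (x : nat -> 'cV[K]_m) (u : nat -> 'cV[K]_r) : \bar K :=
  (\sum_(0 <= l <oo) (qform Q (x l) + qform R (u l))%:E)%E.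

Definition closed_loop (K : realType) (m r : nat) (A : 'M[K]_m)
    (B : 'M[K]_(m, r)) (F : 'M[K]_(r, m)) (x : 'cV[K]_m) (l : nat) : 'cV[K]_m :=
  iter l (mulmx (A + B *m F)) x.

Definition value (K : realType) (m r : nat) (A : 'M[K]_m)
    (B : 'M[K]_(m, r)) (Q : 'M[K]_m) (R : 'M[K]_r) (F : 'M[K]_(r, m))
    (x : 'cV[K]_m) : \bar K :=
  lqr_cost Q R (closed_loop A B F x) (fun l => F *m closed_loop A B F x l).

Definition block_diagonal (K : realType) (n : nat) (p_ : 'I_n -> nat)
    (M : 'M[K]_(\sum_i p_ i)) : Prop :=
  forall i j : 'I_n, i != j -> submxblock M i j = 0.

(* The i-th block of columns of the identity matrix. *)
Definition Pi_ (K : realType) (n : nat) (r_ : 'I_n -> nat) (i : 'I_n) :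
    'M[K]_(\sum_j r_ j, r_ i) :=
  submxrow 1%:M i.

Definition coPi (K : realType) (n : nat) (r_ : 'I_n -> nat) (i : 'I_n) :
    'M[K]_(\sum_j r_ j) :=
  1%:M - Pi_ K r_ i *m (Pi_ K r_ i)^T.

Definition subA (K : realType) (n m : nat) (r_ : 'I_n -> nat) (i : 'I_n)
    (A : 'M[K]_m) (B : 'M[K]_(m, \sum_j r_ j)) (F : 'M[K]_(\sum_j r_ j, m)) :
    'M[K]_m :=
  A + B *m coPi K r_ i *m F.

Definition subB (K : realType) (n m : nat) (r_ : 'I_n -> nat) (i : 'I_n)
    (B : 'M[K]_(m, \sum_j r_ j)) : 'M[K]_(m, r_ i) :=
  B *m Pi_ K r_ i.

Definition subQ (K : realType) (n m : nat) (r_ : 'I_n -> nat) (i : 'I_n)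
    (Q : 'M[K]_m) (R : 'M[K]_(\sum_j r_ j)) (F : 'M[K]_(\sum_j r_ j, m)) :
    'M[K]_m :=
  Q + F^T *m coPi K r_ i *m R *m coPi K r_ i *m F.

Definition subR (K : realType) (n : nat) (r_ : 'I_n -> nat) (i : 'I_n)
    (R : 'M[K]_(\sum_j r_ j)) : 'M[K]_(r_ i) :=
  (Pi_ K r_ i)^T *m R *m Pi_ K r_ i.

(* Block i of F becomes the optimal feedback of subproblem i, the other blocks
   are kept; see [updateP] for the two defining equations. *)
Definition update (K : realType) (n m : nat) (r_ : 'I_n -> nat)
    (A : 'M[K]_m) (B : 'M[K]_(m, \sum_j r_ j))
    (Q : 'M[K]_m) (R : 'M[K]_(\sum_j r_ j)) (i : 'I_n)
    (F : 'M[K]_(\sum_j r_ j, m)) : 'M[K]_(\sum_j r_ j, m) :=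
  coPi K r_ i *m F
  + Pi_ K r_ i *m
      opt_feedback (subA i A B F) (subB i B) (subQ i Q R F) (subR i R).

(* [ordS] is the cyclic successor on ['I_n]. *)
Definition sweep (n : nat) (i : 'I_n) (k : nat) : 'I_n := iter k (@ordS n) i.

Fixpoint split_policy_iter (K : realType) (n m : nat) (r_ : 'I_n -> nat)
    (A : 'M[K]_m) (B : 'M[K]_(m, \sum_j r_ j))
    (Q : 'M[K]_m) (R : 'M[K]_(\sum_j r_ j)) (i : 'I_n)
    (F0 : 'M[K]_(\sum_j r_ j, m)) (k : nat) : 'M[K]_(\sum_j r_ j, m) :=
  if k is k'.+1 then
    update A B Q R (sweep i k') (split_policy_iter A B Q R i F0 k')
  else F0.

Lemma Pi_blockE (K : realType) (n : nat) (r_ : 'I_n -> nat) (i : 'I_n) :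
  submxcol (Pi_ K r_ i) i = 1%:M /\
  forall j, j != i -> submxcol (Pi_ K r_ i) j = 0.
Proof.
rewrite /Pi_ -[1%:M]mxdiagZ /mxdiag.
split=> [|j ji]; rewrite -submxblockEh mxblockK.
  by case: eqP => // ii; rewrite conform_mx_id.
by rewrite (negbTE ji).
Qed.

Lemma Pi_ortho (K : realType) (n : nat) (r_ : 'I_n -> nat) (i : 'I_n) :
  (Pi_ K r_ i)^T *m Pi_ K r_ i = 1%:M.
Proof.
rewrite {2}/Pi_ mul_submxrow mulmx1 /Pi_ tr_submxrow trmx1 -submxblockEv.
by rewrite submxblockEh (Pi_blockE K r_ i).1.
Qed.

Lemma updateP (K : realType) (n m : nat) (r_ : 'I_n -> nat)
    (A : 'M[K]_m) (B : 'M[K]_(m, \sum_j r_ j))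
    (Q : 'M[K]_m) (R : 'M[K]_(\sum_j r_ j)) (i : 'I_n)
    (F Fnew : 'M[K]_(\sum_j r_ j, m)) :
  let Ai := subA i A B F in let Bi := subB i B in
  let Ri := subR i R in let P := the_riccati_sol Ai Bi (subQ i Q R F) Ri in
  Fnew = update A B Q R i F <->
  (Pi_ K r_ i)^T *m Fnew = - (invmx (Ri + Bi^T *m P *m Bi) *m Bi^T *m P *m Ai)
  /\ coPi K r_ i *m Fnew = coPi K r_ i *m F.
Proof.
move=> Ai Bi Ri P; rewrite /update -/Ai -/Bi -/Ri.
set L := opt_feedback _ _ _ _.
rewrite -[- (_ *m Ai)]/L.
have PC : (Pi_ K r_ i)^T *m coPi K r_ i = 0.
  by rewrite mulmxBr mulmx1 mulmxA Pi_ortho mul1mx subrr.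
have CP : coPi K r_ i *m Pi_ K r_ i = 0.
  by rewrite mulmxBl mul1mx -mulmxA Pi_ortho mulmx1 subrr.
have CC : coPi K r_ i *m coPi K r_ i = coPi K r_ i.
  by rewrite {2}/coPi mulmxBr mulmx1 mulmxA CP mul0mx subr0.
split=> [->|[FL FC]].
  by rewrite !mulmxDr !mulmxA PC CP CC Pi_ortho !mul0mx mul1mx add0r addr0.
by rewrite -FL -FC mulmxA -mulmxDl subrK mul1mx.
Qed.

(* Main.v *)
Require Import Defs.
From mathcomp Require Import all_boot all_order all_algebra.
From mathcomp Require Import complex ring lra.
From mathcomp Require Import all_classical all_reals all_analysis.
Import Order.TTheory GRing.Theory Num.Theory.
Import numFieldNormedType.Exports.
Local Open Scope classical_set_scope.
Local Open Scope ring_scope.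
Set Implicit Arguments.
Unset Strict Implicit.

(** Everything is read off the Bellman function
   [q_P(x, u) = x^T Q x + u^T R u + (A x + B u)^T P (A x + B u)].
   Completing the square, [q_P(x, u)] is [x^T (riccati_map P) x] plus a positive
   definite form in the distance from [u] to the Riccati gain
   ([bellman_square]). So the Riccati map is the minimum of [q_P] over [u], and
   it is monotone in [P].

   Value iteration [0, ric 0, ric (ric 0), ...] therefore increases, its [N]-th
   term being below the cost of any [N] steps of control. If it is bounded at
   each state, its limit solves the Riccati equation ([value_iteration_cvg]). A
   solution [P] is unique: under a feedback whose cost is finite the state tends
   to zero, so the terminal cost in [P] vanishes and [P] is at most the cost of
   that feedback ([riccati_sol_min]). A feedback whose cost matrix is positive
   definite is Schur stable by Lyapunov's argument ([evaluates_schur]).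

   Since [R] is block diagonal, the Bellman function of a subproblem is that of
   the full problem with the other inputs prescribed by [F] ([sub_bellman]).
   Hence the solution [P'] of the subproblem is the cost matrix of the updated
   feedback [F'] for the full problem, and it lies below the cost of [F], even
   when that one is infinite, because the truncated costs of [F] bound the value
   iteration of the subproblem. This gives stability and monotonicity, and it
   provides the bound needed at the next step; at the initial step the bound
   comes from controllability, which allows to steer every state to zero in
   finitely many steps.

   For the convergence, the cost matrices [P_k] decrease to some [L]. The square
   completed in block [i_(k+1)] yields
   [x^T (P_k - P_(k+1)) x >= ((F_(k+1) - F_(k+2)) x)^T R ((F_(k+1) - F_(k+2)) x)],
   so consecutive feedbacks approach each other. The gradient of the Bellman
   function at [F_(k+1)] has a vanishing block [i_k] ([update_grad]), each block
   is visited once per sweep, and the gradient varies less and less: it tends to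
   zero ([iter_grad_cvg0]). In the limit the gradient equation says that
   [F_k] tends to the Riccati gain of [L] ([iter_gain_cvg]), and then that [L]
   solves the Riccati equation of the full problem; uniqueness identifies the
   limit ([iter_cvg]). *)

(** * Quadratic forms *)

Definition bform (K : realType) (m p : nat) (x : 'cV[K]_m) (P : 'M[K]_(m, p))
    (y : 'cV[K]_p) : K :=
  (x^T *m P *m y) 0 0.

Definition sym_possemidef (K : realType) (m : nat) (P : 'M[K]_m) : Prop :=
  P^T = P /\ forall x : 'cV[K]_m, 0 <= qform P x.

Section QuadraticForms.
Context {K : realType}.

Lemma bformDl m p x x' (P : 'M[K]_(m, p)) y :
  bform (x + x') P y = bform x P y + bform x' P y.
Proof. by rewrite /bform linearD /= !mulmxDl mxE. Qed.

Lemma bformDr m p x (P : 'M[K]_(m, p)) y y' :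
  bform x P (y + y') = bform x P y + bform x P y'.
Proof. by rewrite /bform !mulmxDr mxE. Qed.

Lemma bformZr m p x (P : 'M[K]_(m, p)) c y :
  bform x P (c *: y) = c * bform x P y.
Proof. by rewrite /bform -scalemxAr mxE. Qed.

Lemma bformDm m p x (P P' : 'M[K]_(m, p)) y :
  bform x (P + P') y = bform x P y + bform x P' y.
Proof. by rewrite /bform mulmxDr mulmxDl mxE. Qed.

Lemma bform0m m p x y : bform x (0 : 'M[K]_(m, p)) y = 0.
Proof. by rewrite /bform mulmx0 mul0mx mxE. Qed.

Lemma bformMl m p q (C : 'M[K]_(m, q)) x (P : 'M[K]_(m, p)) y :
  bform (C *m x) P y = bform x (C^T *m P) y.
Proof. by rewrite /bform trmx_mul !mulmxA. Qed.

Lemma bformMr m p q (C : 'M[K]_(p, q)) x (P : 'M[K]_(m, p)) y :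
  bform x P (C *m y) = bform x (P *m C) y.
Proof. by rewrite /bform !mulmxA. Qed.

Lemma bform_tr m p x (P : 'M[K]_(m, p)) y : bform y P^T x = bform x P y.
Proof.
rewrite /bform; have -> : y^T *m P^T *m x = (x^T *m P *m y)^T.
  by rewrite !trmx_mul trmxK mulmxA.
by rewrite mxE.
Qed.

Lemma bformZl m p c x (P : 'M[K]_(m, p)) y :
  bform (c *: x) P y = c * bform x P y.
Proof. by rewrite -bform_tr bformZr bform_tr. Qed.

Lemma bform_delta m p i j (P : 'M[K]_(m, p)) :
  bform (delta_mx i 0) P (delta_mx j 0) = P i j.
Proof. by rewrite /bform trmx_delta -rowE -colE !mxE. Qed.

Lemma qformE m (P : 'M[K]_m) x : qform P x = bform x P x.
Proof. by []. Qed.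

Lemma qformD m (P : 'M[K]_m) x y : P^T = P ->
  qform P (x + y) = qform P x + 2 * bform x P y + qform P y.
Proof.
move=> sP; rewrite !qformE bformDl !bformDr.
have -> : bform y P x = bform x P y by rewrite -{1}sP bform_tr.
ring.
Qed.

Lemma qformZ m (P : 'M[K]_m) c x : qform P (c *: x) = c ^+ 2 * qform P x.
Proof. by rewrite !qformE bformZr bformZl mulrA -expr2. Qed.

Lemma qform0 m (P : 'M[K]_m) : qform P 0 = 0.
Proof. by rewrite /qform mulmx0 mxE. Qed.

Lemma qformM m p (P : 'M[K]_m) (C : 'M[K]_(m, p)) x :
  qform P (C *m x) = qform (C^T *m P *m C) x.
Proof. by rewrite qformE bformMl bformMr. Qed.

Lemma qformDm m (P P' : 'M[K]_m) x :
  qform (P + P') x = qform P x + qform P' x.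
Proof. exact: bformDm. Qed.

Lemma qform0m m x : qform (0 : 'M[K]_m) x = 0.
Proof. exact: bform0m. Qed.

Lemma sym_entryE m (P : 'M[K]_m) i j : P^T = P ->
  P i j = (qform P (delta_mx i 0 + delta_mx j 0) - qform P (delta_mx i 0)
           - qform P (delta_mx j 0)) / 2.
Proof. by move=> sP; rewrite qformD // bform_delta; field. Qed.

(** By polarization, through [sym_entryE]. *)
Lemma sym_qform_inj m (P P' : 'M[K]_m) : P^T = P -> P'^T = P' ->
  (forall x, qform P x = qform P' x) -> P = P'.
Proof.
by move=> sP sP' e; apply/matrixP => i j; rewrite !sym_entryE // !e.
Qed.

Lemma posdef_semidef m (P : 'M[K]_m) : sym_posdef P -> sym_possemidef P.
Proof.
move=> [sP pP]; split=> // x; have [->|/pP/ltW//] := eqVneq x 0.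
by rewrite qform0.
Qed.

Lemma posdef_unit m (P : 'M[K]_m) : sym_posdef P -> P \in unitmx.
Proof.
move=> [sP pP]; rewrite -row_free_unit; apply/inj_row_free => v vP.
apply/eqP; rewrite -[_ == 0](inj_eq (@trmx_inj _ _ _)) trmx0.
by apply: contraT => /pP; rewrite /qform trmxK vP mul0mx mxE ltxx.
Qed.

Lemma posdefD m (P P' : 'M[K]_m) : sym_posdef P -> sym_possemidef P' ->
  sym_posdef (P + P').
Proof.
move=> [sP pP] [sP' pP']; split; first by rewrite linearD /= sP sP'.
by move=> x /pP x0; rewrite qformDm ltr_wpDr.
Qed.

Lemma semidefM m p (P : 'M[K]_m) (C : 'M[K]_(m, p)) : sym_possemidef P ->
  sym_possemidef (C^T *m P *m C).
Proof.
move=> [sP pP]; split=> [|x]; last by rewrite -qformM.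
by rewrite !trmx_mul trmxK sP mulmxA.
Qed.

(** Cauchy-Schwarz for the scalar product of [P], between [x] and the vector
   [P^-1 e_i] that represents the [i]-th coordinate. *)
Lemma posdef_coord_le m (P : 'M[K]_m) (i : 'I_m) : sym_posdef P ->
  exists2 c, 0 < c & forall x : 'cV[K]_m, x i 0 ^+ 2 <= c * qform P x.
Proof.
move=> dP; have [sP pP] := dP; have uP := posdef_unit dP.
pose w : 'cV[K]_m := invmx P *m delta_mx i 0.
have Pw : P *m w = delta_mx i 0 by rewrite mulKVmx.
have xw x : bform x P w = x i 0.
  by rewrite /bform -mulmxA Pw -colE !mxE.
have w0 : w != 0.
  apply: contra_eq_neq Pw => ->; rewrite mulmx0.
  by apply/eqP => /matrixP /(_ i 0); rewrite !mxE !eqxx /= => /esym/eqP;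
     rewrite oner_eq0.
have c0 := pP _ w0; exists (qform P w) => // x.
set c := qform P w in c0 *.
(* the coefficient of [w] minimizes the form on the line [x + t *: w] *)
have := (posdef_semidef dP).2 (x + (- (x i 0 / c)) *: w).
rewrite qformD // qformZ bformZr xw -/c => h.
have -> : c * qform P x = c * (qform P x + 2 * (- (x i 0 / c) * x i 0) +
          (- (x i 0 / c)) ^+ 2 * c) + x i 0 ^+ 2.
  by field; rewrite gt_eqF.
by rewrite lerDr mulr_ge0 // ltW.
Qed.

End QuadraticForms.

(** * The Bellman function and the Riccati map *)

(** Cost of one step with input [u] from state [x], followed by the terminal
   cost [P]. *)
Definition bellman (K : realType) (m r : nat) (A : 'M[K]_m)
    (B : 'M[K]_(m, r)) (Q : 'M[K]_m) (R : 'M[K]_r) (P : 'M[K]_m)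
    (x : 'cV[K]_m) (u : 'cV[K]_r) : K :=
  qform Q x + qform R u + qform P (A *m x + B *m u).

Definition riccati_gain (K : realType) (m r : nat) (A : 'M[K]_m)
    (B : 'M[K]_(m, r)) (R : 'M[K]_r) (P : 'M[K]_m) : 'M[K]_(r, m) :=
  - (invmx (R + B^T *m P *m B) *m B^T *m P *m A).

(** Half the gradient in [u] of the Bellman function at [u = F x], as a matrix
   acting on [x]. *)
Definition bellman_grad (K : realType) (m r : nat) (A : 'M[K]_m)
    (B : 'M[K]_(m, r)) (R : 'M[K]_r) (P : 'M[K]_m) (F : 'M[K]_(r, m)) :
    'M[K]_(r, m) :=
  R *m F + B^T *m P *m (A + B *m F).

Section Bellman.
Context {K : realType} {m r : nat}.
Variables (A : 'M[K]_m) (B : 'M[K]_(m, r)) (Q : 'M[K]_m) (R : 'M[K]_r).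
Hypotheses (hQ : sym_posdef Q) (hR : sym_posdef R).

Local Notation step := (bellman A B Q R).
Local Notation gain := (riccati_gain A B R).
Local Notation ric := (riccati_map A B Q R).

Lemma hessian_posdef P : sym_possemidef P -> sym_posdef (R + B^T *m P *m B).
Proof. by move=> hP; apply: posdefD => //; exact: semidefM. Qed.

Lemma bellman_gradE P F :
  bellman_grad A B R P F = (R + B^T *m P *m B) *m F + B^T *m P *m A.
Proof.
by rewrite /bellman_grad mulmxDl mulmxDr !mulmxA -addrA [_ + B^T *m P *m A]addrC.
Qed.

Lemma bellman_grad_gain P : sym_possemidef P -> bellman_grad A B R P (gain P) = 0.
Proof.
move=> hP; have uH := posdef_unit (hessian_posdef hP).
rewrite bellman_gradE /riccati_gain; set H := R + _ in uH *.
by rewrite mulmxN -!(mulmxA (invmx H)) mulKVmx // addNr.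
Qed.

Lemma bellman_shift P F x w : P^T = P ->
  step P x (F *m x + w) = step P x (F *m x)
    + 2 * bform w (bellman_grad A B R P F) x + qform (R + B^T *m P *m B) w.
Proof.
move=> sP; have sR := hR.1.
rewrite /bellman mulmxDr addrA !qformD // qformDm -qformM.
have -> : bform (F *m x) R w = bform w (R *m F) x.
  by rewrite -bform_tr sR bformMr.
have -> : bform (A *m x + B *m (F *m x)) P (B *m w) =
          bform w (B^T *m P *m (A + B *m F)) x.
  by rewrite -bform_tr sP bformMl mulmxA -mulmxDl bformMr.
rewrite /bellman_grad bformDm; ring.
Qed.

(** The cross terms in the gain cancel because the gradient vanishes there. *)
Lemma riccati_mapE P x : sym_possemidef P ->
  qform (ric P) x = step P x (gain P *m x).
Proof.
move=> hP; have g0 := bellman_grad_gain hP; have [sP _] := hP.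
have -> : ric P = A^T *m P *m (A + B *m gain P) + Q.
  by rewrite /riccati_map mulmxDr /riccati_gain !mulmxN !mulmxA.
set F := gain P in g0 *; rewrite /bellman qformDm addrC -addrA; congr (_ + _).
have -> : A *m x + B *m (F *m x) = (A + B *m F) *m x by rewrite mulmxDl mulmxA.
have: bform (F *m x) (bellman_grad A B R P F) x = 0 by rewrite g0 bform0m.
rewrite /bellman_grad bformDm => h.
rewrite [qform P _]qformE {1}mulmxDl bformDl bformMl bformMr -qformE.
rewrite -[B *m F *m x]mulmxA bformMl bformMr; rewrite -bformMr -qformE in h.
by rewrite addrCA h addr0.
Qed.

(** Completion of the square: the linear term of [bellman_shift] is the gradient
   at the gain. *)
Lemma bellman_square P x u : sym_possemidef P ->
  step P x u = qform (ric P) x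
    + qform (R + B^T *m P *m B) (u - gain P *m x).
Proof.
move=> hP; have {1}-> : u = gain P *m x + (u - gain P *m x) by rewrite addrC subrK.
rewrite bellman_shift ?bellman_grad_gain // ?bform0m; last exact: hP.1.
by rewrite mulr0 addr0 -riccati_mapE.
Qed.

Lemma riccati_map_le P x u : sym_possemidef P -> qform (ric P) x <= step P x u.
Proof.
move=> hP; rewrite bellman_square // lerDl.
exact: (posdef_semidef (hessian_posdef hP)).2.
Qed.

Lemma bellman_ge P x u : sym_possemidef P -> qform Q x <= step P x u.
Proof.
move=> hP; rewrite /bellman -addrA lerDl addr_ge0 //.
  exact: (posdef_semidef hR).2.
exact: hP.2.
Qed.

Lemma riccati_map_sym P : P^T = P -> (ric P)^T = ric P.
Proof.
move=> sP; have sR := hR.1; have sQ := hQ.1.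
rewrite /riccati_map !linearD /= linearN /= !trmx_mul !trmxK trmx_inv !linearD /=.
by rewrite !trmx_mul !trmxK sP sR sQ !mulmxA.
Qed.

Lemma riccati_map_posdef P : sym_possemidef P -> sym_posdef (ric P).
Proof.
move=> hP; split; first exact: riccati_map_sym hP.1.
move=> x x0; rewrite riccati_mapE //.
by apply: lt_le_trans (bellman_ge _ _ hP); exact: hQ.2.
Qed.

Lemma riccati_map_mono P P' : sym_possemidef P -> sym_possemidef P' ->
  (forall x, qform P x <= qform P' x) ->
  forall x, qform (ric P) x <= qform (ric P') x.
Proof.
move=> hP hP' le x; rewrite (riccati_mapE _ hP').
by apply: le_trans (riccati_map_le x (gain P' *m x) hP) _; rewrite lerD2l.
Qed.

End Bellman.

(** * Limits of matrices *)

Section MatrixLimits.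
Context {K : realType}.

Lemma cvg_succn (T : topologicalType) (u : nat -> T) (l : T) :
  u @ \oo --> l -> (fun k => u k.+1) @ \oo --> l.
Proof.
move=> h S hS; have [N _ hN] := h S hS; exists N => // k /= Nk.
by apply: hN; exact: leqW.
Qed.

Lemma cvg_predn (T : topologicalType) (u : nat -> T) (l : T) :
  (fun k => u k.+1) @ \oo --> l -> u @ \oo --> l.
Proof.
move=> h S hS; have [N _ hN] := h S hS; exists N.+1 => // -[|k] //= Nk.
exact: hN.
Qed.

Lemma cvgn_le (f g : nat -> K) (l l' : K) : f @ \oo --> l -> g @ \oo --> l' ->
  (forall k, f k <= g k) -> l <= l'.
Proof. by move=> hf hg le; apply: (ler_cvg_to hf hg); exact: nearW. Qed.

Lemma cvg_mxP m p (M : nat -> 'M[K]_(m, p)) (L : 'M[K]_(m, p)) :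
  M @ \oo --> L <-> forall i j, (fun k => M k i j) @ \oo --> L i j.
Proof.
split=> [h i j A hA | h A [B hB BA]].
  apply: (h [set N : 'M[K]_(m, p) | A (N i j)]).
  exists (fun i' j' => if (i' == i) && (j' == j) then A else setT).
    move=> i' j'; case: andP => [[/eqP-> /eqP->]//|_]; exact: filterT.
  by move=> N /(_ i j); rewrite !eqxx.
have : \forall k \near \oo, forall i j, B i j (M k i j).
  apply: filter_forall => i; apply: filter_forall => j; exact: h (hB i j).
by apply: filterS => k hk; apply: BA.
Qed.

Lemma cvg_scalar_sum (I : Type) (r : seq I) (P : pred I)
    (f : I -> nat -> K) (l : I -> K) :
  (forall i, P i -> f i @ \oo --> l i) ->
  (fun k => \sum_(i <- r | P i) f i k) @ \oo --> \sum_(i <- r | P i) l i.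
Proof. move=> h; apply: cvg_big => //; exact: add_continuous. Qed.

Lemma cvg_scalar_prod (I : Type) (r : seq I) (P : pred I)
    (f : I -> nat -> K) (l : I -> K) :
  (forall i, P i -> f i @ \oo --> l i) ->
  (fun k => \prod_(i <- r | P i) f i k) @ \oo --> \prod_(i <- r | P i) l i.
Proof. move=> h; apply: cvg_big => //; exact: mul_continuous. Qed.

Lemma cvg_mxD m p (M N : nat -> 'M[K]_(m, p)) (L L' : 'M[K]_(m, p)) :
  M @ \oo --> L -> N @ \oo --> L' -> (fun k => M k + N k) @ \oo --> L + L'.
Proof.
move=> /cvg_mxP hM /cvg_mxP hN; apply/cvg_mxP => i j; rewrite mxE.
under eq_cvg do rewrite mxE; exact: cvgD.
Qed.

Lemma cvg_mxN m p (M : nat -> 'M[K]_(m, p)) (L : 'M[K]_(m, p)) :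
  M @ \oo --> L -> (fun k => - M k) @ \oo --> - L.
Proof.
move=> /cvg_mxP hM; apply/cvg_mxP => i j; rewrite mxE.
under eq_cvg do rewrite mxE; exact: cvgN.
Qed.

Lemma cvg_mxB m p (M N : nat -> 'M[K]_(m, p)) (L L' : 'M[K]_(m, p)) :
  M @ \oo --> L -> N @ \oo --> L' -> (fun k => M k - N k) @ \oo --> L - L'.
Proof. by move=> hM hN; apply: cvg_mxD => //; exact: cvg_mxN. Qed.

Lemma cvg_mulmx m p q (M : nat -> 'M[K]_(m, p)) (N : nat -> 'M[K]_(p, q))
    (L : 'M[K]_(m, p)) (L' : 'M[K]_(p, q)) :
  M @ \oo --> L -> N @ \oo --> L' -> (fun k => M k *m N k) @ \oo --> L *m L'.
Proof.
move=> /cvg_mxP hM /cvg_mxP hN; apply/cvg_mxP => i j; rewrite mxE.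
under eq_cvg do rewrite mxE.
by apply: cvg_scalar_sum => l _; exact: cvgM.
Qed.

Lemma cvg_mx_cst m p (X : 'M[K]_(m, p)) : (fun _ : nat => X) @ \oo --> X.
Proof. exact: cvg_cst. Qed.

Lemma cvg_mulmxl m p q (X : 'M[K]_(m, p)) (M : nat -> 'M[K]_(p, q))
    (L : 'M[K]_(p, q)) :
  M @ \oo --> L -> (fun k => X *m M k) @ \oo --> X *m L.
Proof. by move=> h; apply: cvg_mulmx h; exact: cvg_mx_cst. Qed.

Lemma cvg_mulmxlr m p q s (X : 'M[K]_(m, p)) (M : nat -> 'M[K]_(p, q))
    (L : 'M[K]_(p, q)) (Y : 'M[K]_(q, s)) :
  M @ \oo --> L -> (fun k => X *m M k *m Y) @ \oo --> X *m L *m Y.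
Proof.
by move=> h; apply: cvg_mulmx; [exact: cvg_mulmxl|exact: cvg_mx_cst].
Qed.

Lemma cvg_det m (M : nat -> 'M[K]_m) (L : 'M[K]_m) :
  M @ \oo --> L -> (fun k => \det (M k)) @ \oo --> \det L.
Proof.
move=> /cvg_mxP hM; rewrite /determinant; apply: cvg_scalar_sum => s _.
apply: (cvgM (cvg_cst _)).
by apply: cvg_scalar_prod => i _; exact: hM.
Qed.

(** By Cramer's formula, all of whose terms are polynomials in the entries, save
   for the inverse of the determinant. *)
Lemma cvg_invmx m (M : nat -> 'M[K]_m) (L : 'M[K]_m) : (forall k, M k \in unitmx) ->
  L \in unitmx -> M @ \oo --> L -> (fun k => invmx (M k)) @ \oo --> invmx L.
Proof.
move=> uM uL hM; apply/cvg_mxP => i j.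
rewrite /invmx uL mxE [_ i j]mxE.
under eq_cvg do rewrite uM mxE [_ i j]mxE.
apply: cvgM; first by apply: cvgV; [rewrite -unitfE -unitmxE | exact: cvg_det].
apply: cvgM; first exact: cvg_cst.
apply: cvg_det; move/cvg_mxP: hM => hM; apply/cvg_mxP => i' j'; rewrite !mxE.
under eq_cvg do rewrite !mxE; exact: hM.
Qed.

Lemma cvg_qform m (P : nat -> 'M[K]_m) (L : 'M[K]_m)
    (x : nat -> 'cV[K]_m) (y : 'cV[K]_m) :
  P @ \oo --> L -> x @ \oo --> y ->
  (fun k => qform (P k) (x k)) @ \oo --> qform L y.
Proof.
move=> hP hx.
have hxT : (fun k => (x k)^T) @ \oo --> y^T.
  move/cvg_mxP: hx => hx; apply/cvg_mxP => i j; rewrite mxE.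
  under eq_cvg do rewrite mxE; exact: hx.
by have /cvg_mxP := cvg_mulmx (cvg_mulmx hxT hP) hx; exact.
Qed.

(** By polarization, the entries are combinations of converging values of the
   quadratic forms. *)
Lemma cvg_sym_mx m (P : nat -> 'M[K]_m) : (forall k, (P k)^T = P k) ->
  (forall x, cvgn (fun k => qform (P k) x)) -> exists L : 'M[K]_m, P @ \oo --> L.
Proof.
move=> sP cP.
pose q (x : 'cV[K]_m) := limn (fun k => qform (P k) x).
exists (\matrix_(i, j) ((q (delta_mx i 0 + delta_mx j 0) - q (delta_mx i 0)
           - q (delta_mx j 0)) / 2)).
apply/cvg_mxP => i j; rewrite mxE.
under eq_cvg do rewrite sym_entryE //.
apply: cvgM; last exact: cvg_cst.
by apply: cvgB; [apply: cvgB|]; exact: cP.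
Qed.

Lemma cvg_mx_sym m (P : nat -> 'M[K]_m) (L : 'M[K]_m) : (forall k, (P k)^T = P k) ->
  P @ \oo --> L -> L^T = L.
Proof.
move=> sP /cvg_mxP hP; apply/matrixP => i j; rewrite mxE.
apply: (cvg_unique _ (hP j i)) => //.
have := hP i j.
by under eq_cvg do rewrite -sP mxE.
Qed.

Lemma cvg_posdef0 m (P : 'M[K]_m) (x : nat -> 'cV[K]_m) : sym_posdef P ->
  (fun k => qform P (x k)) @ \oo --> (0 : K) -> x @ \oo --> (0 : 'cV[K]_m).
Proof.
move=> dP hx; apply/cvg_mxP => i j; rewrite mxE ord1.
have [c c0 le] := posdef_coord_le i dP.
have h2 : (fun k => x k i 0 ^+ 2) @ \oo --> (0 : K).
  apply: (@squeeze_cvgr _ _ _ _ (cst 0) (fun k => c * qform P (x k))).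
  - by near=> k; rewrite sqr_ge0 le.
  - exact: cvg_cst.
  - by rewrite -(mulr0 c); apply: cvgM => //; exact: cvg_cst.
apply/cvgr0Pnorm_lt => e e0.
have e2 : 0 < e ^+ 2 by rewrite exprn_gt0.
move/cvgr0Pnorm_lt: h2 => /(_ _ e2); apply: filterS => k.
by rewrite normrX ltr_pXn2r // ?nnegrE // ltW.
Unshelve. all: end_near. Qed.

Lemma cvg_bounded_mulmx0 m p q (M : nat -> 'M[K]_(m, p)) (N : nat -> 'M[K]_(p, q)) :
  M @ \oo --> (0 : 'M[K]_(m, p)) ->
  (forall i j, exists C, forall k, `|N k i j| <= C) ->
  (fun k => M k *m N k) @ \oo --> (0 : 'M[K]_(m, q)).
Proof.
move=> /cvg_mxP hM hN; apply/cvg_mxP => i j; rewrite mxE.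
under eq_cvg do rewrite mxE.
suff h : (fun k => \sum_l M k i l * N k l j) @ \oo --> \sum_(l < p) (0 : K).
  by rewrite big1 in h.
apply: cvg_scalar_sum => l _; apply: norm_cvg0; have [C hC] := hN l j.
apply: (@squeeze_cvgr _ _ _ _ (cst 0) (fun k => `|M k i l| * C)).
- by near=> k; rewrite normr_ge0 normrM ler_wpM2l.
- exact: cvg_cst.
- rewrite -(mul0r C); apply: cvgM; last exact: cvg_cst.
  by have := hM i l; rewrite mxE => /cvg_norm; rewrite normr0.
Unshelve. all: end_near. Qed.

End MatrixLimits.

Arguments cvg_mx_cst {K m p} X.
Arguments cvg_mulmxl {K m p q} X {M L}.
Arguments cvg_mulmxlr {K m p q s} X {M L} Y.

(** * Value iteration *)

(** Starting from [0], so that the [N]-th iterate has no terminal cost. *)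
Definition value_iteration (K : realType) (m r : nat) (A : 'M[K]_m)
    (B : 'M[K]_(m, r)) (Q : 'M[K]_m) (R : 'M[K]_r) (N : nat) : 'M[K]_m :=
  iter N (riccati_map A B Q R) 0.

Section ValueIteration.
Context {K : realType} {m r : nat}.
Variables (A : 'M[K]_m) (B : 'M[K]_(m, r)) (Q : 'M[K]_m) (R : 'M[K]_r).
Hypotheses (hQ : sym_posdef Q) (hR : sym_posdef R).

Local Notation vi := (value_iteration A B Q R).

Lemma value_iteration_semidef N : sym_possemidef (vi N).
Proof.
elim: N => [|N IH].
  by split=> [|x]; rewrite ?trmx0 ?qform0m.
exact/posdef_semidef/riccati_map_posdef.
Qed.

Lemma value_iteration_incr N x : qform (vi N) x <= qform (vi N.+1) x.
Proof.
elim: N x => [|N IH] x.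
  by rewrite qform0m; exact: (value_iteration_semidef 1).2.
exact: (riccati_map_mono A B Q hR (value_iteration_semidef N)
         (value_iteration_semidef N.+1) IH).
Qed.

(** Bellman's principle: the first of [N.+1] steps costs at least the minimum
   over the first input, with the minimal cost of the last [N] as terminal
   cost. *)
Lemma value_iteration_le_cost (u : nat -> 'cV[K]_r) (x : nat -> 'cV[K]_m) N :
  (forall l, x l.+1 = A *m x l + B *m u l) ->
  qform (vi N) (x 0%N) <= \sum_(0 <= l < N) (qform Q (x l) + qform R (u l)).
Proof.
elim: N u x => [|N IH] u x dyn; first by rewrite qform0m big_geq.
apply: le_trans (riccati_map_le A B Q hR _ (u 0%N) (value_iteration_semidef N)) _.
rewrite /bellman -dyn big_nat_recl // lerD2l.
exact: (IH (fun l => u l.+1) (fun l => x l.+1)).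
Qed.

Lemma value_iteration_bound_step x u :
  (exists C, forall N, qform (vi N) (A *m x + B *m u) <= C) ->
  exists C, forall N, qform (vi N) x <= C.
Proof.
move=> [C hC]; exists (qform Q x + qform R u + C) => N.
apply: le_trans (value_iteration_incr N x) _.
apply: le_trans (riccati_map_le A B Q hR _ u (value_iteration_semidef N)) _.
by rewrite lerD2l.
Qed.

(** The hypothesis says that the inputs [- u] steer [x] to the origin, where no
   cost accrues, in [k] steps. The first input is the one that [A ^+ k.-1]
   multiplies, so the induction on [k] peels off one step of the trajectory. *)
Lemma value_iteration_bound_steerable k x (u : 'I_k -> 'cV[K]_r) :
  A ^+ k *m x = \sum_(l < k) A ^+ l *m B *m u l ->
  exists C, forall N, qform (vi N) x <= C.
Proof.
elim: k x u => [|k IH] x u.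
  rewrite big_ord0 expr0 mul1mx => ->.
  by exists 0 => N; rewrite qform0.
rewrite big_ord_recr /= exprSr -[A ^+ k * A]/(A ^+ k *m A) => e.
apply: (value_iteration_bound_step (u := - u ord_max)).
apply: (IH _ (fun l => u (widen_ord (leqnSn k) l))).
by rewrite mulmxDr !mulmxA e !mulmxN addrK.
Qed.

(** The controllability matrix has full rank, so [A ^+ m *m x] is in its
   image. *)
Lemma value_iteration_bound_controllable x : controllable A B ->
  exists C, forall N, qform (vi N) x <= C.
Proof.
move=> hc; set W := \mxrow_(k < m) (A ^+ k *m B) in hc.
have fW : row_full W^T by rewrite /row_full mxrank_tr hc.
have /submxP[D hD] : ((A ^+ m *m x)^T <= W^T)%MS by exact: submx_full.
pose y := D^T.
have hy : A ^+ m *m x = W *m y by rewrite -[LHS]trmxK hD trmx_mul trmxK.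
apply: (@value_iteration_bound_steerable m x (fun l => submxcol y l)).
by rewrite hy -[y in LHS]submxcolK mul_mxrow_mxcol.
Qed.

(** The minimal costs over [N] steps increase with [N]; if they are bounded,
   their limit is a fixed point of the continuous Riccati map. *)
Lemma value_iteration_cvg :
  (forall x, exists C, forall N, qform (vi N) x <= C) ->
  exists P : 'M[K]_m, riccati_sol A B Q R P /\ vi @ \oo --> P.
Proof.
move=> bnd; have sd := value_iteration_semidef.
have cq x : cvgn (fun N => qform (vi N) x).
  have [C hC] := bnd x; apply: nondecreasing_is_cvgn.
    by apply/nondecreasing_seqP => N; exact: value_iteration_incr.
  by exists C => _ [N _ <-].
have [P hP] := cvg_sym_mx (fun N => (sd N).1) cq.
exists P; split=> //.
have sP : P^T = P := cvg_mx_sym (fun N => (sd N).1) hP.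
have geQ x : qform Q x <= qform P x.
  apply: (@cvgn_le _ (cst (qform Q x)) (fun N => qform (vi N.+1) x)).
  - exact: cvg_cst.
  - apply: (@cvg_succn K (fun N => qform (vi N) x)).
    by apply: (@cvg_qform K m vi _ (fun=> x)) => //; exact: cvg_cst.
  - by move=> N; rewrite /= riccati_mapE //; exact: bellman_ge.
have pP : sym_posdef P.
  by split=> // x /hQ.2 x0; exact: lt_le_trans (geQ x).
split=> //.
apply: (cvg_unique _ (F := vi N.+1 @[N --> \oo])) => //.
  exact: cvg_succn.
rewrite /= /riccati_map; apply: cvg_mxD; last exact: cvg_mx_cst.
apply: cvg_mxB; first exact: cvg_mulmxlr.
apply: cvg_mulmx; last exact: cvg_mx_cst.
apply: cvg_mulmx; last exact: hP.
apply: cvg_mulmx; last exact: cvg_mx_cst.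
apply: cvg_mulmx; first exact: cvg_mulmxlr.
apply: cvg_invmx.
- by move=> N; exact/posdef_unit/hessian_posdef.
- exact/posdef_unit/hessian_posdef/posdef_semidef.
- exact: cvg_mxD (cvg_mx_cst R) (cvg_mulmxlr B^T B hP).
Qed.

End ValueIteration.

(** * Stationary policies *)

(** The Lyapunov equation
   [P = Q + F^T R F + (A + B F)^T P (A + B F)], written with quadratic forms: [P]
   is the cost matrix of the feedback [F]. *)
Definition evaluates (K : realType) (m r : nat) (A : 'M[K]_m)
    (B : 'M[K]_(m, r)) (Q : 'M[K]_m) (R : 'M[K]_r) (P : 'M[K]_m)
    (F : 'M[K]_(r, m)) : Prop :=
  forall x, qform P x = bellman A B Q R P x (F *m x).

Section Policy.
Context {K : realType} {m r : nat}.
Variables (A : 'M[K]_m) (B : 'M[K]_(m, r)) (Q : 'M[K]_m) (R : 'M[K]_r).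
Hypotheses (hQ : sym_posdef Q) (hR : sym_posdef R).

Local Notation step := (bellman A B Q R).
Local Notation gain := (riccati_gain A B R).
Local Notation evaluates := (evaluates A B Q R).
Local Notation cl := (closed_loop A B).

Definition stage_cost (x : 'cV[K]_m) (u : 'cV[K]_r) : K := qform Q x + qform R u.

Lemma stage_cost_ge0 x u : 0 <= stage_cost x u.
Proof.
by rewrite addr_ge0 ?(posdef_semidef hQ).2 ?(posdef_semidef hR).2.
Qed.

Lemma riccati_sol_evaluates P : riccati_sol A B Q R P -> evaluates P (gain P).
Proof.
by move=> [pP eP] x; rewrite -riccati_mapE -?eP //; exact: posdef_semidef.
Qed.

Lemma riccati_sol_le P x u : riccati_sol A B Q R P -> qform P x <= step P x u.
Proof.
by move=> [pP eP]; rewrite {1}eP; apply: riccati_map_le => //; exact: posdef_semidef.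
Qed.

Lemma closed_loopE F x l : cl F x l.+1 = A *m cl F x l + B *m (F *m cl F x l).
Proof. by rewrite /closed_loop iterS mulmxDl mulmxA. Qed.

Lemma evaluates_partial P F x N : evaluates P F ->
  qform P x = \sum_(0 <= l < N) stage_cost (cl F x l) (F *m cl F x l)
    + qform P (cl F x N).
Proof.
move=> e; elim: N => [|N IH]; first by rewrite big_geq // add0r.
by rewrite IH big_nat_recr //= -addrA (e (cl F x N)) /bellman -closed_loopE.
Qed.

Lemma riccati_sol_partial_le P F x N : riccati_sol A B Q R P ->
  qform P x <= \sum_(0 <= l < N) stage_cost (cl F x l) (F *m cl F x l)
    + qform P (cl F x N).
Proof.
move=> e; elim: N => [|N IH]; first by rewrite big_geq // add0r.
apply: le_trans IH _; rewrite big_nat_recr //= -addrA lerD2l.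
apply: le_trans (riccati_sol_le _ (F *m cl F x N) e) _.
by rewrite /bellman -closed_loopE.
Qed.

Lemma partial_cost_le_value F x N :
  ((\sum_(0 <= l < N) stage_cost (cl F x l) (F *m cl F x l))%:E
   <= value A B Q R F x)%E.
Proof.
rewrite -sumEFin /value /lqr_cost.
by apply: nneseries_lim_ge => l _ _; rewrite lee_fin stage_cost_ge0.
Qed.

Lemma value_le P F x : sym_possemidef P -> evaluates P F ->
  (value A B Q R F x <= (qform P x)%:E)%E.
Proof.
move=> sP e; apply: lime_le.
  by apply: is_cvg_nneseries => l _ _; rewrite lee_fin stage_cost_ge0.
apply: nearW => N; rewrite sumEFin lee_fin (evaluates_partial x N e) lerDl.
exact: sP.2.
Qed.

(** The nonnegative cost-to-go decreases by at least [qform Q] at each step, so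
   [qform Q] tends to zero along the trajectory. *)
Lemma closed_loop_cvg0 P F x : sym_possemidef P -> evaluates P F ->
  cl F x @ \oo --> (0 : 'cV[K]_m).
Proof.
move=> sP e; apply: (cvg_posdef0 hQ).
pose q l := qform P (cl F x l).
have dq l : qform Q (cl F x l) <= q l - q l.+1.
  rewrite /q (e (cl F x l)) /bellman -closed_loopE addrK lerDl.
  exact: (posdef_semidef hR).2.
have cq : cvgn q.
  apply: nonincreasing_is_cvgn.
    apply/nonincreasing_seqP => l; rewrite -subr_ge0.
    exact: le_trans ((posdef_semidef hQ).2 _) (dq l).
  by exists 0 => _ [l _ <-]; exact: sP.2.
have cq0 : (fun l => q l - q l.+1) @ \oo --> (0 : K).
  rewrite -(subrr (limn q)); apply: cvgB => //.
  exact: (@cvg_succn K q).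
apply: (@squeeze_cvgr _ _ _ _ (cst 0) (fun l => q l - q l.+1)) => //.
- by near=> l; rewrite (posdef_semidef hQ).2 /=.
- exact: cvg_cst.
Unshelve. all: end_near. Qed.

(** Over [N] steps of [F], the Bellman inequality bounds [P] by the cost of these
   steps plus the terminal cost in [P], and the latter tends to zero with the
   state. *)
Lemma riccati_sol_min P P' F x : riccati_sol A B Q R P ->
  sym_possemidef P' -> evaluates P' F -> qform P x <= qform P' x.
Proof.
move=> hP sP' e.
have h0 : (fun N => qform P (cl F x N)) @ \oo --> (0 : K).
  rewrite -(qform0 P); apply: cvg_qform; first exact: cvg_cst.
  exact: closed_loop_cvg0 e.
apply: (@cvgn_le _ (cst (qform P x))
          (fun N => qform P' x + qform P (cl F x N))).
- exact: cvg_cst.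
- by rewrite -[X in _ --> X]addr0; apply: cvgD => //; exact: cvg_cst.
- move=> N /=; apply: le_trans (riccati_sol_partial_le F x N hP) _.
  by rewrite lerD2r (evaluates_partial x N e) lerDl; exact: sP'.2.
Qed.

Lemma riccati_sol_uniq P P' :
  riccati_sol A B Q R P -> riccati_sol A B Q R P' -> P = P'.
Proof.
move=> hP hP'; apply: sym_qform_inj => [||x]; [exact: hP.1.1|exact: hP'.1.1|].
have sP := posdef_semidef hP.1; have sP' := posdef_semidef hP'.1.
apply/eqP; rewrite eq_le.
by rewrite (riccati_sol_min x hP sP' (riccati_sol_evaluates hP'))
           (riccati_sol_min x hP' sP (riccati_sol_evaluates hP)).
Qed.

Lemma the_riccati_solE P : riccati_sol A B Q R P -> the_riccati_sol A B Q R = P.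
Proof.
move=> hP; rewrite /the_riccati_sol; case: xgetP => [P' _ [hP' _]|/(_ P)[]].
  exact: riccati_sol_uniq.
by split=> // P'; exact: riccati_sol_uniq.
Qed.

(** Lyapunov's argument: if [x] and [y] are the real and imaginary parts of an
   eigenvector for [z], one step of the closed loop multiplies
   [qform P x + qform P y] by [|z|^2]; but it also decreases this quantity by at
   least [qform Q x + qform Q y > 0]. *)
Lemma evaluates_schur P F : sym_posdef P -> evaluates P F ->
  schur_stable (A + B *m F).
Proof.
move=> dP e z; set M := A + B *m F.
have dec (x : 'cV[K]_m) : qform P (M *m x) = qform P x - stage_cost x (F *m x).
  by rewrite (e x) /bellman /stage_cost /M mulmxDl -mulmxA; ring.
clearbody M; set Mc := map_mx _ _ => ez.
(* [eigenvalue] refers to row eigenvectors; a column eigenvector is needed. *)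
have : eigenvalue Mc^T z.
  move: ez; rewrite /eigenvalue /eigenspace !kermx_eq0 !row_free_unit.
  by rewrite -(unitmx_tr (Mc - _)) linearB /= tr_scalar_mx.
case/eigenvalueP => v vM v0; case: z {ez} vM => a b vM.
pose x : 'cV[K]_m := \col_j complex.Re (v 0 j).
pose y : 'cV[K]_m := \col_j complex.Im (v 0 j).
have Mv j : \sum_k (M j k)%:C%C * v 0 k = Complex a b * v 0 j.
  move/matrixP: vM => /(_ 0 j); rewrite !mxE => <-.
  by apply: eq_bigr => k _; rewrite !mxE mulrC.
have Mx : M *m x = a *: x - b *: y.
  apply/matrixP => j k; rewrite !mxE.
  have /(congr1 (@complex.Re K)) := Mv j.
  rewrite raddf_sum /=; case: (v 0 j) => c d /= <-.
  by apply: eq_bigr => l _; rewrite mxE; case: (v 0 l) => e' f' /=; ring.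
have My : M *m y = b *: x + a *: y.
  apply/matrixP => j k; rewrite !mxE.
  have /(congr1 (@complex.Im K)) := Mv j.
  rewrite raddf_sum /=; case: (v 0 j) => c d /= e'; rewrite addrC -e'.
  by apply: eq_bigr => l _; rewrite mxE; case: (v 0 l) => e'' f' /=; ring.
have sQ := posdef_semidef hQ; have sP := posdef_semidef dP.
have xy0 : 0 < qform Q x + qform Q y.
  have [x0|x0] := eqVneq x 0; last by rewrite ltr_pwDl ?sQ.2 ?hQ.2.
  have [y0|y0] := eqVneq y 0; last by rewrite ltr_wpDl ?sQ.2 ?hQ.2.
  case/negP: v0; apply/eqP/matrixP => i j; rewrite ord1 mxE.
  move/matrixP: x0 => /(_ j 0); move/matrixP: y0 => /(_ j 0); rewrite !mxE.
  by case: (v 0 j) => c d /= -> ->.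
have scQ w u : qform Q w <= stage_cost w u.
  by rewrite lerDl (posdef_semidef hR).2.
have eqP : (a ^+ 2 + b ^+ 2) * (qform P x + qform P y) =
    qform P (M *m x) + qform P (M *m y).
  by rewrite Mx My -scaleNr !qformD ?dP.1 // !qformZ !bformZr !bformZl; ring.
have lt1 : a ^+ 2 + b ^+ 2 < 1.
  have xyP : 0 < qform P x + qform P y.
    apply: lt_le_trans xy0 _; rewrite lerD //.
      by rewrite (e x); exact: bellman_ge.
    by rewrite (e y); exact: bellman_ge.
  rewrite -(ltr_pM2r xyP) mul1r eqP !dec.
  have := scQ x (F *m x); have := scQ y (F *m y); lra.
by rewrite normc_def /= -[1]/(1%:C)%C ltcR -sqrtr1 ltr_sqrt.
Qed.

End Policy.

(** * Updating one subsystem *)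

Section BlockProjections.
Context {K : realType} {n : nat} (r_ : 'I_n -> nat).

Local Notation Pi := (Pi_ K r_).
Local Notation coPi := (coPi K r_).

Lemma sum_Pi : \sum_j Pi j *m (Pi j)^T = 1%:M.
Proof.
rewrite -mul_mxrow_mxcol /Pi_ submxrowK.
have -> : \mxcol_j (submxrow (1%:M : 'M[K]_(\sum_j r_ j)) j)^T = 1%:M.
  rewrite -[RHS]submxcolK; apply: eq_mxcol => j.
  by rewrite tr_submxrow trmx1.
by rewrite mul1mx.
Qed.

Lemma coPi_sum i : coPi i = \sum_(j | j != i) Pi j *m (Pi j)^T.
Proof.
have := sum_Pi; rewrite [LHS](bigD1 i) //= /Defs.coPi => <-.
by rewrite addrAC subrr add0r.
Qed.

Lemma tr_coPi i : (coPi i)^T = coPi i.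
Proof. by rewrite /Defs.coPi linearB /= trmx1 trmx_mul trmxK. Qed.

Lemma coPi_decomp p i (F : 'M[K]_(_, p)) :
  coPi i *m F + Pi i *m ((Pi i)^T *m F) = F.
Proof. by rewrite mulmxA -mulmxDl subrK mul1mx. Qed.

Lemma Pi_conj_submxblock (R : 'M[K]_(\sum_j r_ j)) i j :
  (Pi i)^T *m R *m Pi j = submxblock R i j.
Proof.
rewrite -mulmxA {2}/Pi_ mul_submxrow mulmx1 /Pi_ tr_submxrow trmx1.
by rewrite submxcol_mul mul1mx -submxblockEh.
Qed.

Lemma block_diagonal_cross (R : 'M[K]_(\sum_j r_ j)) i : block_diagonal R ->
  (Pi i)^T *m R *m coPi i = 0.
Proof.
move=> dR; rewrite coPi_sum mulmx_sumr; apply: big1 => j ji.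
by rewrite mulmxA Pi_conj_submxblock dR ?mul0mx // eq_sym.
Qed.

End BlockProjections.

Section Subsystem.
Context {K : realType} {n m : nat} {r_ : 'I_n -> nat}.
Variables (A : 'M[K]_m) (B : 'M[K]_(m, \sum_j r_ j)).
Variables (Q : 'M[K]_m) (R : 'M[K]_(\sum_j r_ j)).
Hypotheses (hQ : sym_posdef Q) (hR : sym_posdef R) (hRd : block_diagonal R).
Variables (i : 'I_n) (F : 'M[K]_(\sum_j r_ j, m)).

Local Notation Pi := (Pi_ K r_ i).
Local Notation coPi := (coPi K r_ i).
Local Notation Ai := (subA i A B F).
Local Notation Bi := (subB i B).
Local Notation Qi := (subQ i Q R F).
Local Notation Ri := (subR i R).
Local Notation vi := (value_iteration Ai Bi Qi Ri).
Local Notation P' := (the_riccati_sol Ai Bi Qi Ri).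
Local Notation F' := (update A B Q R i F).
Local Notation f := (riccati_gain Ai Bi Ri P').

Lemma subQ_posdef : sym_posdef Qi.
Proof.
apply: posdefD => //.
have -> : F^T *m coPi *m R *m coPi *m F = (coPi *m F)^T *m R *m (coPi *m F).
  by rewrite trmx_mul tr_coPi !mulmxA.
exact/semidefM/posdef_semidef.
Qed.

Lemma subR_posdef : sym_posdef Ri.
Proof.
split=> [|v v0].
  exact: (semidefM Pi (posdef_semidef hR)).1.
rewrite -qformM hR.2 //; apply: contraNneq v0 => /(congr1 (mulmx Pi^T)).
by rewrite mulmxA Pi_ortho mul1mx mulmx0 => ->.
Qed.

(** As [R] has no entries coupling block [i] to the others, the Bellman function
   of the subproblem is that of the full problem with the other inputs given by
   [F]. *)
Lemma sub_bellman P x v :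
  bellman Ai Bi Qi Ri P x v = bellman A B Q R P x (coPi *m (F *m x) + Pi *m v).
Proof.
have cr := block_diagonal_cross i hRd.
rewrite /bellman qformDm.
have -> : Ai *m x + Bi *m v = A *m x + B *m (coPi *m (F *m x) + Pi *m v).
  by rewrite mulmxDl mulmxDr !mulmxA addrA.
congr (_ + _); rewrite -addrA; congr (_ + _).
rewrite [in RHS]addrC qformD ?hR.1 // addrC; congr (_ + _).
  rewrite bformMl bformMr cr bform0m mulr0 addr0.
  by rewrite -qformM.
by rewrite !qformM tr_coPi !mulmxA.
Qed.

Lemma sub_bellman_policy P x :
  bellman Ai Bi Qi Ri P x (Pi^T *m (F *m x)) = bellman A B Q R P x (F *m x).
Proof. by rewrite sub_bellman coPi_decomp. Qed.

Lemma sub_stage_cost x :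
  qform Qi x + qform Ri (Pi^T *m (F *m x)) = qform Q x + qform R (F *m x).
Proof.
have := sub_bellman_policy 0 x; rewrite /bellman !qform0m !addr0; exact.
Qed.

(** The inputs that [F] gives to block [i] are admissible for the subproblem, and
   with them the subproblem follows the closed loop of [F] at the same cost. *)
Lemma sub_value_iteration_le_value N x :
  ((qform (vi N) x)%:E <= value A B Q R F x)%E.
Proof.
apply: le_trans (partial_cost_le_value A B hQ hR F x N).
rewrite lee_fin.
apply: le_trans (value_iteration_le_cost subQ_posdef subR_posdef
  (u := fun l => Pi^T *m (F *m closed_loop A B F x l))
  (x := closed_loop A B F x) N _) _ => [l|].
  by rewrite closed_loopE -[F *m _ in LHS](coPi_decomp i) mulmxDr !mulmxA
             addrA -!mulmxDl.
by apply: ler_sum => l _; rewrite sub_stage_cost.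
Qed.

(* Holds if the subproblem is controllable, or if the cost of [F] is finite. *)
Hypothesis bnd : forall x, exists C, forall N, qform (vi N) x <= C.

Lemma sub_riccati_sol : riccati_sol Ai Bi Qi Ri P' /\ vi @ \oo --> P'.
Proof.
have [P [sP lP]] := value_iteration_cvg subQ_posdef subR_posdef bnd.
by rewrite (the_riccati_solE subQ_posdef subR_posdef sP).
Qed.

Lemma sub_sol_posdef : sym_posdef P'.
Proof. exact: sub_riccati_sol.1.1. Qed.

Lemma updateE : F' = coPi *m F + Pi *m f.
Proof. by []. Qed.

Lemma update_block : Pi^T *m F' = f.
Proof. exact: ((updateP A B Q R i F F').1 erefl).1. Qed.

Lemma update_coblock : coPi *m F' = coPi *m F.
Proof. exact: ((updateP A B Q R i F F').1 erefl).2. Qed.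

Lemma update_evaluates : evaluates A B Q R P' F'.
Proof.
move=> x; rewrite (riccati_sol_evaluates subR_posdef sub_riccati_sol.1) sub_bellman.
by rewrite updateE mulmxDl !mulmxA.
Qed.

(** [P'] is the limit of the minimal costs over [N] steps. The argument compares
   truncated costs only, so the cost of [F] may be infinite. *)
Lemma update_le_value x : ((qform P' x)%:E <= value A B Q R F x)%E.
Proof.
have := sub_value_iteration_le_value ^~ x.
case: value => [v le|_|/(_ 0%N)//]; last exact: leey.
rewrite lee_fin; apply: (@cvgn_le _ (fun N => qform (vi N) x) (cst v)).
- by apply: cvg_qform; [exact: sub_riccati_sol.2|exact: cvg_cst].
- exact: cvg_cst.
- by move=> N; rewrite -lee_fin.
Qed.

(** The square completed in block [i], whose Hessian is at least
   [subR i R]. *)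
Lemma update_improvement x :
  qform P' x + qform R ((F - F') *m x) <= bellman A B Q R P' x (F *m x).
Proof.
have sP := posdef_semidef sub_sol_posdef.
rewrite -sub_bellman_policy (bellman_square _ _ _ subR_posdef) //.
rewrite -sub_riccati_sol.1.2 lerD2l qformDm -qformM.
have <- : Pi *m (Pi^T *m (F *m x) - f *m x) = (F - F') *m x.
  have c0 : coPi *m (F - F') = 0 by rewrite mulmxBr update_coblock subrr.
  rewrite -[RHS](coPi_decomp i) (mulmxA coPi) c0 mul0mx add0r; congr (_ *m _).
  by rewrite -update_block -mulmxA -mulmxBr -mulmxBl.
by rewrite qformM lerDl sP.2.
Qed.

(** Block [i] of the gradient of the full Bellman function is the gradient for
   the subproblem, which vanishes at its Riccati gain. *)
Lemma update_grad : Pi^T *m bellman_grad A B R P' F' = 0.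
Proof.
have sP := posdef_semidef sub_sol_posdef.
rewrite -(bellman_grad_gain Ai Bi subR_posdef sP) /bellman_grad mulmxDr.
congr (_ + _).
  rewrite updateE !mulmxDr !mulmxA (block_diagonal_cross i hRd) mul0mx.
  by rewrite add0r.
have -> : Ai + Bi *m f = A + B *m F'.
  by rewrite updateE mulmxDr !mulmxA addrA.
by rewrite /subB trmx_mul !mulmxA.
Qed.

End Subsystem.

(** * Convergence of the split policy iteration *)

Lemma sweepE n (i : 'I_n) k : sweep i k = ((i + k) %% n)%N :> nat.
Proof.
elim: k => [|k IH]; first by rewrite addn0 modn_small.
by rewrite /sweep iterS -/(sweep i k) /= IH -addn1 modnDml addn1 addnS.
Qed.

Lemma sweep_visits n (i j : 'I_n) k : exists2 t, (t < n)%N & sweep i (k + t) = j.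
Proof.
have n0 : (0 < n)%N by apply: leq_ltn_trans (ltn_ord i).
pose a := ((i + k) %% n)%N; have an : (a < n)%N by rewrite ltn_mod.
(* [j - a] modulo [n], kept nonnegative *)
exists ((j + (n - a)) %% n)%N; first by rewrite ltn_mod.
apply: val_inj; rewrite /= sweepE addnA -modnDml -/a modnDmr addnCA subnKC 1?ltnW //.
by rewrite modnDr modn_small.
Qed.

Section Iteration.
Context {K : realType} {n m : nat} {r_ : 'I_n -> nat}.
Variables (A : 'M[K]_m) (B : 'M[K]_(m, \sum_j r_ j)).
Variables (Q : 'M[K]_m) (R : 'M[K]_(\sum_j r_ j)).
Hypotheses (hQ : sym_posdef Q) (hR : sym_posdef R) (hRd : block_diagonal R).
Variables (F0 : 'M[K]_(\sum_j r_ j, m)) (i : 'I_n).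
Hypothesis hctrl : controllable (subA i A B F0) (subB i B).

Local Notation F := (split_policy_iter A B Q R i F0).
Local Notation Ak k := (subA (sweep i k) A B (F k)).
Local Notation Bk k := (subB (sweep i k) B).
Local Notation Qk k := (subQ (sweep i k) Q R (F k)).
Local Notation Rk k := (subR (sweep i k) R).

(** The cost matrix of the policy [F k.+1]. *)
Definition iter_cost (k : nat) : 'M[K]_m :=
  the_riccati_sol (Ak k) (Bk k) (Qk k) (Rk k).

Local Notation P := iter_cost.

(** Controllability is used for [k = 0] only; later the previous cost matrix
   bounds the cost of [F k]. *)
Lemma iter_bound k x : exists C, forall N,
  qform (value_iteration (Ak k) (Bk k) (Qk k) (Rk k) N) x <= C.
Proof.
elim: k x => [|k IH] x.
  apply: (value_iteration_bound_controllable (subQ_posdef hQ hR i F0)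
            (subR_posdef hR i)).
  exact: hctrl.
exists (qform (P k) x) => N; rewrite -lee_fin.
apply: le_trans (sub_value_iteration_le_value A B hQ hR hRd _ _ N x) _.
apply: value_le => //.
  exact/posdef_semidef/(sub_sol_posdef hQ hR IH).
exact: (update_evaluates hQ hR hRd IH).
Qed.

Lemma iter_cost_posdef k : sym_posdef (P k).
Proof. exact: (sub_sol_posdef hQ hR (iter_bound k)). Qed.

Lemma iter_cost_evaluates k : evaluates A B Q R (P k) (F k.+1).
Proof. exact: (update_evaluates hQ hR hRd (iter_bound k)). Qed.

Lemma iter_value_le_cost k x :
  (value A B Q R (F k.+1) x <= (qform (P k) x)%:E)%E.
Proof.
apply: value_le => //; last exact: iter_cost_evaluates.
exact/posdef_semidef/iter_cost_posdef.
Qed.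

Lemma iter_cost_le_value k x :
  ((qform (P k) x)%:E <= value A B Q R (F k) x)%E.
Proof. exact: (update_le_value hQ hR hRd (iter_bound k)). Qed.

Lemma iter_cost_decr k x : qform (P k.+1) x <= qform (P k) x.
Proof.
rewrite -lee_fin.
exact: le_trans (iter_cost_le_value k.+1 x) (iter_value_le_cost k x).
Qed.

Lemma iter_cost_improvement k x :
  qform R ((F k.+1 - F k.+2) *m x) <= qform (P k) x - qform (P k.+1) x.
Proof.
rewrite lerBrDl.
apply: le_trans (update_improvement hQ hR hRd (iter_bound k.+1) x) _.
by rewrite (iter_cost_evaluates k x) lerD2l iter_cost_decr.
Qed.

Lemma iter_cost_cvg : exists L : 'M[K]_m, P @ \oo --> L.
Proof.
apply: cvg_sym_mx => [k|x]; first exact: (iter_cost_posdef k).1.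
apply: nonincreasing_is_cvgn.
  by apply/nonincreasing_seqP => k; exact: iter_cost_decr.
by exists 0 => _ [k _ <-]; exact: (posdef_semidef (iter_cost_posdef k)).2.
Qed.

(** By [iter_cost_improvement], applied to the basis vectors. *)
Lemma iter_diff_cvg0 :
  (fun k => F k.+2 - F k.+1) @ \oo --> (0 : 'M[K]_(\sum_j r_ j, m)).
Proof.
have [L hL] := iter_cost_cvg.
apply/cvg_mxP => a b; rewrite mxE.
pose x : 'cV[K]_m := delta_mx b 0.
suff /cvg_mxP /(_ a 0) : (fun k => (F k.+1 - F k.+2) *m x) @ \oo -->
    (0 : 'cV[K]_(\sum_j r_ j)).
  have e k : (F k.+2 - F k.+1) a b = - ((F k.+1 - F k.+2) *m x) a 0.
    by rewrite /x -colE -opprB !mxE.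
  by under [X in _ -> X]eq_cvg do rewrite e; rewrite mxE => /cvgN; rewrite oppr0.
apply: (cvg_posdef0 hR).
apply: (@squeeze_cvgr _ _ _ _ (cst 0)
          (fun k => qform (P k) x - qform (P k.+1) x)).
- by apply: nearW => k /=; rewrite (posdef_semidef hR).2 iter_cost_improvement.
- exact: cvg_cst.
- have hPx : (fun k => qform (P k) x) @ \oo --> qform L x.
    by apply: cvg_qform; [exact: hL|exact: cvg_cst].
  rewrite -(subrr (qform L x)); apply: cvgB => //.
  exact: (@cvg_succn K (fun k => qform (P k) x)).
Qed.

(** The form [F k.+1 ^T R F k.+1] is part of the cost [P k], which is at most
   [P 0]. *)
Lemma iter_bounded a b : exists C, forall k, `|F k.+1 a b| <= C.
Proof.
have [c c0 le] := posdef_coord_le a hR.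
pose x : 'cV[K]_m := delta_mx b 0.
(* [c * qform (P 0) x] bounds the square of the entry, and [z <= 1 + z ^+ 2] *)
exists (1 + c * qform (P 0%N) x) => k.
have d0 : qform (P k) x <= qform (P 0%N) x.
  by elim: k => [|k IH] //; exact: le_trans (iter_cost_decr k x) IH.
have sPk := posdef_semidef (iter_cost_posdef k).
have h : F k.+1 a b ^+ 2 <= c * qform (P 0%N) x.
  have -> : F k.+1 a b = (F k.+1 *m x) a 0 by rewrite /x -colE [RHS]mxE.
  apply: le_trans (le _) _; rewrite ler_pM2l //; apply: le_trans _ d0.
  rewrite (iter_cost_evaluates k x) /bellman addrAC lerDr addr_ge0 //.
    exact: (posdef_semidef hQ).2.
  exact: sPk.2.
set y := F k.+1 a b in h *.
apply: le_trans (_ : 1 + y ^+ 2 <= _); last by rewrite lerD2l.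
rewrite -real_normK ?num_real //; set z := `|y|.
have : 0 <= (z - 1) ^+ 2 + z ^+ 2 + 1 by rewrite !addr_ge0 // sqr_ge0.
nra.
Qed.

Local Notation G k := (bellman_grad A B R (P k) (F k.+1)).
Local Notation H k := (R + B^T *m P k *m B).

(** The gradient is [H k *m F k.+1 + B^T *m P k *m A]; its increments are controlled
   by those of [P] and [F], as [H k] converges and [F k] is bounded. *)
Lemma iter_grad_diff_cvg0 t :
  (fun k => G (k + t)%N - G k) @ \oo --> (0 : 'M[K]_(\sum_j r_ j, m)).
Proof.
have [L hL] := iter_cost_cvg.
have hH := cvg_mxD (cvg_mx_cst R) (cvg_mulmxlr B^T B hL).
have d1 : (fun k => G k.+1 - G k) @ \oo --> (0 : 'M[K]_(\sum_j r_ j, m)).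
  have e k : G k.+1 - G k = (H k.+1 - H k) *m F k.+2
      + H k *m (F k.+2 - F k.+1) + (B^T *m P k.+1 *m A - B^T *m P k *m A).
    rewrite !bellman_gradE opprD addrACA; congr (_ + _).
    by rewrite mulmxBl mulmxBr [RHS]addrA subrK.
  under eq_cvg do rewrite e.
  have z3 : (0 : 'M[K]_(\sum_j r_ j, m)) =
      0 + (R + B^T *m L *m B) *m 0 + (B^T *m L *m A - B^T *m L *m A).
    by rewrite mulmx0 subrr !addr0.
  rewrite z3; apply: cvg_mxD; last first.
    have hM := cvg_mulmxlr B^T A hL.
    exact: cvg_mxB (@cvg_succn _ (fun k => B^T *m P k *m A) _ hM) hM.
  apply: cvg_mxD; last exact: cvg_mulmx hH iter_diff_cvg0.
  apply: cvg_bounded_mulmx0.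
    rewrite -(subrr (R + B^T *m L *m B)); apply: cvg_mxB => //.
    exact: (@cvg_succn _ (fun k => H k)).
  move=> a b; have [C hC] := iter_bounded a b; exists C => k; exact: hC.
elim: t => [|t IH].
  under eq_cvg do rewrite addn0 subrr; exact: cvg_mx_cst.
have e k : G (k + t.+1)%N - G k =
    (G (k + t).+1%N - G (k + t)%N) + (G (k + t)%N - G k).
  by rewrite addnS addrA subrK.
under eq_cvg do rewrite e.
rewrite -(addr0 (0 : 'M[K]_(_, _))); apply: cvg_mxD => //.
exact: (cvg_comp (fun k => (k + t)%N) _ (cvg_addnr t) d1).
Qed.

(** For every [k], block [j] of the gradient vanishes at some index between [k]
   and [k + n - 1], so at [k] it is at most the sum of its variations over these
   indices. *)
Lemma iter_grad_cvg0 :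
  (fun k => G k) @ \oo --> (0 : 'M[K]_(\sum_j r_ j, m)).
Proof.
have blk j : (fun k => (Pi_ K r_ j)^T *m G k) @ \oo --> (0 : 'M[K]_(r_ j, m)).
  apply/cvg_mxP => a b; rewrite mxE; apply: norm_cvg0.
  pose d t k := `|((Pi_ K r_ j)^T *m (G (k + t)%N - G k)) a b|.
  apply: (@squeeze_cvgr _ _ _ _ (cst 0) (fun k => \sum_(t < n) d t k)).
  - apply: nearW => k; apply/andP; split; first exact: normr_ge0.
    have [t tn st] := sweep_visits i j k.
    have g0 : (Pi_ K r_ j)^T *m G (k + t)%N = 0.
      by rewrite -st; exact: (update_grad hQ hR hRd (iter_bound (k + t)%N)).
    apply: (@le_trans _ _ (d t k)).
      by rewrite /d mulmxBr g0 sub0r [in leRHS]mxE normrN.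
    rewrite [leRHS](bigD1 (Ordinal tn)) // lerDl.
    by apply: sumr_ge0 => t' _; exact: normr_ge0.
  - exact: cvg_cst.
  - suff : (fun k => \sum_(t < n) d t k) @ \oo --> \sum_(t < n) (0 : K).
      by rewrite big1.
    apply: cvg_scalar_sum => t _.
    have /cvg_mxP /(_ a b) := cvg_mulmxl (Pi_ K r_ j)^T (iter_grad_diff_cvg0 t).
    by rewrite mulmx0 mxE => /cvg_norm; rewrite normr0.
apply/cvg_mxP => a b; rewrite mxE.
have e k : G k a b = \sum_j (Pi_ K r_ j *m ((Pi_ K r_ j)^T *m G k)) a b.
  rewrite -summxE; congr (fun_of_matrix _ a b); rewrite -[LHS]mul1mx -sum_Pi.
  by rewrite mulmx_suml; apply: eq_bigr => j _; rewrite mulmxA.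
under eq_cvg do rewrite e.
have z : \sum_(j < n) (0 : K) = 0 by rewrite big1.
suff : (fun k => \sum_j (Pi_ K r_ j *m ((Pi_ K r_ j)^T *m G k)) a b) @ \oo -->
   \sum_(j < n) (0 : K) by rewrite z.
apply: cvg_scalar_sum => j _.
have /cvg_mxP /(_ a b) := cvg_mulmxl (Pi_ K r_ j) (blk j).
by rewrite mulmx0 mxE.
Qed.

(** The gradient determines the feedback:
   [F k.+1 = invmx (H k) *m (G k - B^T *m P k *m A)]. *)
Lemma iter_gain_cvg (L : 'M[K]_m) : sym_posdef L -> P @ \oo --> L ->
  F @ \oo --> riccati_gain A B R L.
Proof.
move=> dL hL; apply: cvg_predn.
have uH k : H k \in unitmx.
  exact/posdef_unit/hessian_posdef/posdef_semidef/iter_cost_posdef.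
have e k : F k.+1 = invmx (H k) *m (G k - B^T *m P k *m A).
  by rewrite bellman_gradE addrK mulKmx.
under eq_cvg do rewrite e.
have -> : riccati_gain A B R L =
    invmx (R + B^T *m L *m B) *m (0 - B^T *m L *m A).
  by rewrite sub0r mulmxN !mulmxA.
apply: cvg_mulmx; last exact: cvg_mxB iter_grad_cvg0 (cvg_mulmxlr B^T A hL).
apply: cvg_invmx => //; first exact/posdef_unit/hessian_posdef/posdef_semidef.
exact: cvg_mxD (cvg_mx_cst R) (cvg_mulmxlr B^T B hL).
Qed.

(** In the limit, the Lyapunov equation of the pair [P k], [F k.+1] becomes that
   of [L] and its Riccati gain, which is the Riccati equation of [L]. *)
Lemma iter_cvg : F @ \oo --> opt_feedback A B Q R.
Proof.
have [L hL] := iter_cost_cvg.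
have sL : L^T = L := cvg_mx_sym (fun k => (iter_cost_posdef k).1) hL.
have cP x : (fun k => qform (P k) x) @ \oo --> qform L x.
  by apply: cvg_qform; [exact: hL|exact: cvg_cst].
have dL : sym_posdef L.
  split=> // x /hQ.2 x0; apply: lt_le_trans x0 _.
  apply: (@cvgn_le _ (cst (qform Q x)) (fun k => qform (P k) x)) => //.
    exact: cvg_cst.
  move=> k; rewrite (iter_cost_evaluates k x); apply: bellman_ge => //.
  exact/posdef_semidef/iter_cost_posdef.
have sdL := posdef_semidef dL.
have cF := iter_gain_cvg dL hL.
suff sol : riccati_sol A B Q R L.
  by rewrite /opt_feedback (the_riccati_solE hQ hR sol).
split=> //; apply: sym_qform_inj => [||x] //.
  exact: (riccati_map_posdef A B hQ hR sdL).1.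
rewrite (riccati_mapE A B Q hR) //.
apply: (cvg_unique _ (cP x)) => //.
have e k : qform (P k) x = bellman A B Q R (P k) x (F k.+1 *m x).
  exact: iter_cost_evaluates.
rewrite /mkset; under eq_cvg do rewrite e.
have cFx : (fun k => F k.+1 *m x) @ \oo --> riccati_gain A B R L *m x.
  exact: cvg_mulmx (@cvg_succn _ F _ cF) (cvg_mx_cst x).
apply: cvgD; last first.
  apply: cvg_qform => //; apply: cvg_mxD (cvg_mx_cst _) _.
  exact: cvg_mulmxl cFx.
apply: cvgD; first exact: cvg_cst.
exact: cvg_qform (cvg_mx_cst R) cFx.
Qed.

End Iteration.

Theorem theorem8 (K : realType) (n : nat) (m_ r_ : 'I_n -> nat)
    (A : 'M[K]_(\sum_j m_ j)) (B : 'M[K]_(\sum_j m_ j, \sum_j r_ j))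
    (Q : 'M[K]_(\sum_j m_ j)) (R : 'M[K]_(\sum_j r_ j))
    (hQ : sym_posdef Q) (hQd : block_diagonal Q)
    (hR : sym_posdef R) (hRd : block_diagonal R)
    (F0 : 'M[K]_(\sum_j r_ j, \sum_j m_ j)) (i : 'I_n)
    (hctrl : controllable (subA i A B F0) (subB i B)) :
  let F := split_policy_iter A B Q R i F0 in
  [/\ forall k : nat, (1 <= k)%N -> schur_stable (A + B *m F k),
      forall (k : nat) (x : 'cV[K]_(\sum_j m_ j)),
        (value A B Q R (F k.+1) x <= value A B Q R (F k) x)%E
    & F @ \oo --> opt_feedback A B Q R].
Proof.
split=> [[//|k] _|k x|]; last exact: iter_cvg.
- apply: (evaluates_schur hQ hR); first exact: (iter_cost_posdef hQ hR hRd hctrl k).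
  exact: iter_cost_evaluates.
- exact: le_trans (iter_value_le_cost hQ hR hRd hctrl k x)
                  (iter_cost_le_value hQ hR hRd hctrl k x).
Qed.
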